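(* Let $\alpha\ge0$. (1) Suppose that $\Phi:\mathcal T^N\to\mathbb R$ is an $\alpha$-potential function for the original (pure) stopping game with payoffs $(J_i)_{i\in[N]}$, and define $$\Phi^R(p):=\int_{[0,1]^N}\Phi\big(\Theta^{1,p^1}(\cdot,u_1),\dots,\Theta^{N,p^N}(\cdot,u_N)\big)\,du,\qquad p\in\mathcal R^N .$$ Then $\Phi^R$ is an $\alpha$-potential function for the canonical randomized game with payoffs $(J_i^R)_{i\in[N]}$. (2) Conversely, if $\Phi^R:\mathcal R^N\to\mathbb R$ is an $\alpha$-potential function for the randomized game, then $\Phi(\tau):=\Phi^R(\iota(\tau))$, $\tau\in\mathcal T^N$, is an $\alpha$-potential function for the pure game.
   Context: Fix $N\ge 2$ and $[N]=\{1,\dots,N\}$. $(\Omega,\mathcal F,\mathbb F,\mathbb P)$ is a filtered probability space satisfying the usual conditions, where $\mathbb F=(\mathcal F_t)_{t\ge 0}$ is generated by a continuous exogenous state process $X=(X_t)_{t\ge0}$. $\mathcal T$ is the set of $\mathbb F$-stopping times $\tau:\Omega\to[0,\infty)$. Pure game. For each $i\in[N]$, $G_i:\Omega\times[0,\infty)^N\to\mathbb R$ is $\mathcal F\otimes\mathcal B([0,\infty)^N)$-measurable, with $G_i(\tau)(\omega):=G_i(\omega,\tau^1(\omega),\dots,\tau^N(\omega))$ and $\sup_{\tau\in\mathcal T^N}\mathbb E[|G_i(\tau)|]<\infty$. Put $J_i(\tau):=\mathbb E[G_i(\tau)]$. Randomized game. $\mathcal R$ is the set of processes $p:[0,\infty)\times\Omega\to[0,1]$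 that are $\mathbb F$-adapted, càdlàg, nondecreasing, with $p_{0-}=0$ and $p_\infty=1$. For $p\in\mathcal R^N$ and $u\in[0,1]^N$ let $\Theta^{i,p^i}(\omega,u_i):=\inf\{t\ge0:p^i_t(\omega)>u_i\}$ (the convention at $u_i=1$ is immaterial). The randomized payoff is $J_i^R(p):=\int_{[0,1]^N}J_i(\Theta^{1,p^1}(\cdot,u_1),\dots,\Theta^{N,p^N}(\cdot,u_N))\,du$ (equivalently, the expectation of $G_i$ at the stopping profile $(\Theta^{i,p^i}(\cdot,U^i))_i$ with $U^1,\dots,U^N$ i.i.d. uniform on $[0,1]$, independent of $\mathcal F$). The canonical embedding $\iota:\mathcal T^N\to\mathcal R^N$ is $\iota(\tau)^i_t=\mathbf 1_{\{\tau^i\le t\}}$. $\alpha$-potential function. For a strategy set $\mathcal A=\prod_i\mathcal A_i$ (with all $\mathcal A_i=\mathcal T$ for the pure game, all $\mathcal A_i=\mathcal R$ for the randomized game) and payoffs $K_i:\mathcal A\to\mathbb R$, a functional $\Psi:\mathcal A\to\mathbb R$ is an $\alpha$-potential function if for every $i\in[N]$, every $a=(a^i,a^{-i})\in\mathcal A$ and every unilateral deviation $\widetilde a^i\in\mathcal A_i$, $$\Big|[K_i(\widetilde a^i,a^{-i})-K_i(a^i,a^{-i})]-[\Psi(\widetilde a^i,a^{-i})-\Psi(a^i,a^{-i})]\Big|\le\alpha .$$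
   Formalization: In part (1) it is additionally assumed that, for every p, the map u ↦ Φ(Θ^{1,p^1}(·,u_1),…,Θ^{N,p^N}(·,u_N)) is Lebesgue measurable on [0,1]^N; without this the integral defining Φ^R(p) may be undefined when α>0. *)

(* Defs.v *)
From HB Require Import structures.
From mathcomp Require Import all_boot all_order all_algebra.
From mathcomp Require Import all_classical all_reals all_analysis.
Import Order.TTheory GRing.Theory Num.Theory.
Import numFieldNormedType.Exports.

Set Implicit Arguments.
Unset Strict Implicit.
Unset Printing Implicit Defensive.

Local Open Scope classical_set_scope.
Local Open Scope ring_scope.

Section lebesgue_tuple_step.
Context (R : realType) (n : nat).
Variable mu : {sigma_finite_measure set (n.-tuple R) -> \bar R}.

Definition tuple_cons (x : measurableTypeR R * n.-tuple R) : n.+1.-tuple R :=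
  [tuple of (x.1 : R) :: x.2].

Lemma measurable_tuple_cons :
  measurable_fun [set: measurableTypeR R * n.-tuple R] tuple_cons.
Proof.
apply: (@measurable_cons _ _ _ R fst n snd) => //.
Qed.

Definition lebesgue_tupleS : set (n.+1.-tuple R) -> \bar R :=
  pushforward (@lebesgue_measure R \x mu)%E tuple_cons.

Let step0 : lebesgue_tupleS set0 = 0%E.
Proof. by rewrite /lebesgue_tupleS /pushforward preimage_set0 measure0. Qed.

Let step_ge0 A : (0 <= lebesgue_tupleS A)%E.
Proof. by rewrite /lebesgue_tupleS /pushforward; apply: measure_ge0. Qed.

Let mpre (A : set (n.+1.-tuple R)) :
  measurable A -> measurable (tuple_cons @^-1` A).
Proof.
move=> mA; rewrite -[X in measurable X]setTI; exact: measurable_tuple_cons.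
Qed.

Let step_sigma_additive : semi_sigma_additive lebesgue_tupleS.
Proof.
move=> F mF tF mUF; rewrite /lebesgue_tupleS /pushforward preimage_bigcup.
apply: measure_semi_sigma_additive.
- by move=> k; exact: mpre.
- apply/trivIsetP => /= i j _ _ ij; rewrite -preimage_setI.
  by move/trivIsetP : tF => /(_ _ _ _ _ ij) ->//; rewrite preimage_set0.
- by rewrite -preimage_bigcup; exact: mpre.
Qed.

HB.instance Definition _ := isMeasure.Build _ _ _ lebesgue_tupleS
  step0 step_ge0 step_sigma_additive.

Lemma tuple_cons_uncons (A : set (measurableTypeR R * n.-tuple R)) :
  tuple_cons @^-1` [set x | A (thead x, [tuple of behead x])] = A.
Proof.
apply/seteqP; split => -[a b] /=; rewrite /tuple_cons theadE.
  by congr (A (_, _)); exact: val_inj.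
by congr (A (_, _)); exact: val_inj.
Qed.

Let step_sigma_finite : sigma_finite setT lebesgue_tupleS.
Proof.
have [F FT Fp] : sigma_finite setT (@lebesgue_measure R \x mu)%E.
  have /sigma_finiteP[F [TF ndF Foo]] :=
    sigma_finiteT (@lebesgue_measure R : {sigma_finite_measure set _ -> \bar R}).
  have /sigma_finiteP[G [TG ndG Goo]] := sigma_finiteT mu.
  exists (fun k => F k `*` G k).
    rewrite -setXTT TF TG predeqE => -[x y]; split.
      move=> [/= [i _ Fix] [j _ Gjy]]; exists (maxn i j) => //; split.
      - by move: x Fix; exact/subsetPset/ndF/leq_maxl.
      - by move: y Gjy; exact/subsetPset/ndG/leq_maxr.
    by move=> [k _ []/= ? ?]; split; exists k.
  move=> k; have [? ?] := Foo k; have [? ?] := Goo k.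
  split; first exact: measurableX.
  by rewrite product_measure1E// lte_mul_pinfty// ge0_fin_numE.
exists (fun k => [set x | F k (thead x, [tuple of behead x])]).
  apply/seteqP; split => // x _.
  have : [set: measurableTypeR R * n.-tuple R]
    (thead x, [tuple of behead x]) by [].
  by rewrite FT => -[k _ Fk]; exists k.
move=> k; have [mFk Fkoo] := Fp k; split.
  have mh : measurable_fun [set: n.+1.-tuple R]
      (fun x : n.+1.-tuple R =>
        (thead x : measurableTypeR R, [tuple of behead x])).
    apply/measurable_fun_pairP; split => /=.
      exact: measurable_tnth.
    exact: measurable_behead.
  by rewrite -[X in measurable X]setTI; exact: mh.
by rewrite /lebesgue_tupleS /pushforward tuple_cons_uncons.
Qed.

HB.instance Definition _ := Measure_isSigmaFinite.Build _ _ _ lebesgue_tupleS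
  step_sigma_finite.

End lebesgue_tuple_step.

Fixpoint lebesgue_tuple (R : realType) (n : nat) :
    {sigma_finite_measure set (n.-tuple R) -> \bar R} :=
  match n with
  | 0 => (\d_([tuple] : 0.-tuple R))%R
  | m.+1 => @lebesgue_tupleS R m (lebesgue_tuple R m)
  end.

Lemma lebesgue_tuple_box (R : realType) (n : nat) (A : 'I_n -> set R) :
  (forall i, measurable (A i)) ->
  lebesgue_tuple R n [set x | forall i, A i (tnth x i)] =
  (\prod_(i < n) @lebesgue_measure R (A i))%E.
Proof.
elim: n A => [|n IHn] A mA /=.
  rewrite big_ord0 diracE mem_set//= => -[]//.
rewrite big_ord_recl -(IHn (fun i => A (lift ord0 i)))//.
rewrite /lebesgue_tupleS /pushforward.
set B := [set x : n.-tuple R | _].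
have mB : measurable B.
  rewrite (_ : B = \big[setI/setT]_(i < n)
      ((fun x : n.-tuple R => tnth x i) @^-1` A (lift ord0 i))).
    apply: bigsetI_measurable => i _; rewrite -[X in measurable X]setTI.
    exact: measurable_tnth.
  rewrite -bigcap_seq; apply/seteqP; split => x /= h i; first by move=> _; exact: h.
  by apply: h => /=; rewrite mem_index_enum.
rewrite -(product_measure1E (@lebesgue_measure R) (lebesgue_tuple R n))//; last exact: mA.
congr (_ _); apply/seteqP; split => -[a b] /=.
  move=> h; split; first exact: (h ord0).
  by move=> i /=; have := h (lift ord0 i); rewrite tnthS.
move=> [Aa Bb] i; have [j ->|->] := unliftP ord0 i; last exact: Aa.
by rewrite tnthS; exact: Bb.
Qed.

(* Time is [0, +oo[, encoded as the nonnegative elements of R; a filtration is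
   only constrained, and only ever used, at times t >= 0. *)
Record usual_filtration (R : realType) (d : measure_display)
    (Omega : measurableType d) (P : probability Omega R) := UsualFiltration {
  filt :> R -> set (set Omega) ;
  filt_sigma : forall t : R, 0 <= t -> sigma_algebra setT (filt t) ;
  filt_sub : forall t : R, 0 <= t -> filt t `<=` measurable ;
  filt_mono : forall s t : R, 0 <= s -> s <= t -> filt s `<=` filt t ;
  (* with filt_sub, this also says that P itself is complete *)
  filt_complete : P.-negligible `<=` filt 0 ;
  filt_rcont : forall t : R, 0 <= t -> \bigcap_(s in `]t, +oo[) filt s = filt t }.

Definition continuous_process (R : realType) (Omega : Type)
    (E : topologicalType) (X : R -> Omega -> E) :=
  forall w, {within `[0, +oo[, continuous (fun t => X t w)}.

Definition past_events (R : realType) (Omega : Type) (E : topologicalType)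
    (X : R -> Omega -> E) (t : R) : set (set Omega) :=
  [set A | exists2 s : R, 0 <= s <= t & exists2 U, open U & A = X s @^-1` U].

(* The usual augmentation of the natural filtration of X.  If the natural
   filtration, or its completion, already satisfies the usual conditions, then
   it coincides with this one. *)
Definition generated_by (R : realType) (d : measure_display)
    (Omega : measurableType d) (P : probability Omega R)
    (F : usual_filtration P) (E : topologicalType) (X : R -> Omega -> E) :=
  forall t : R, 0 <= t ->
    F t = \bigcap_(s in `]t, +oo[) <<s past_events X s `|` P.-negligible >>.

Section strategies.
Context (R : realType) (d : measure_display) (Omega : measurableType d).
Context (P : probability Omega R) (F : usual_filtration P).

Record stopping_time := StoppingTime {
  st_fun :> Omega -> R ;
  st_ge0 : forall w, 0 <= st_fun w ;
  st_adapted : forall t : R, 0 <= t -> F t [set w | st_fun w <= t] }.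

(* Paths are extended by 0 to negative times, which encodes p_{0-} = 0. *)
Record randomized_stopping_time := RandomizedStoppingTime {
  rst_fun :> R -> Omega -> R ;
  rst_lt0 : forall (t : R) w, t < 0 -> rst_fun t w = 0 ;
  rst_itv : forall (t : R) w, 0 <= t -> 0 <= rst_fun t w <= 1 ;
  rst_adapted : forall t : R, 0 <= t ->
    forall B : set R, measurable B -> F t (rst_fun t @^-1` B) ;
  rst_rcont : forall w (t : R), 0 <= t ->
    rst_fun s w @[s --> t^'+] --> rst_fun t w ;
  rst_llim : forall w (t : R), 0 <= t -> cvg (rst_fun s w @[s --> t^'-]) ;
  rst_nd : forall w (s t : R), 0 <= s -> s <= t -> rst_fun s w <= rst_fun t w ;
  rst_infty : forall w, rst_fun t w @[t --> +oo] --> (1 : R) }.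

(* For u >= 1 the set is empty, and its infimum is 0 by convention. *)
Definition Theta_fun (p : randomized_stopping_time) (u : R) (w : Omega) : R :=
  inf [set t : R | 0 <= t /\ u < p t w].

Lemma Theta_ge0 p u w : 0 <= Theta_fun p u w.
Proof.
rewrite /Theta_fun; set A := [set t | _].
have [->|/set0P A0] := eqVneq A set0; first by rewrite inf0.
by apply: lb_le_inf => // t [].
Qed.

Lemma Theta_le p u w t : u < 1 -> 0 <= t ->
  Theta_fun p u w <= t <-> forall s, t < s -> u < p s w.
Proof.
move=> u1 t0; rewrite /Theta_fun; set A := [set t | _].
have lbA : has_lbound A by exists 0 => r [].
have A0 : A !=set0.
  have [M [_ hM]] : \forall s \near +oo, u < p s w.
    by apply: (cvgr_gt _ (rst_infty p w)).
  exists (Num.max M 0 + 1); split.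
    by rewrite addr_ge0// le_max lexx orbT.
  by apply: hM; rewrite ltr_pwDr// le_max lexx.
split=> [At s ts|h].
  have [r [r0 ur] rs] : exists2 r, A r & r < s.
    by apply: inf_lt => //; exact: le_lt_trans ts.
  by apply: (lt_le_trans ur); apply: rst_nd => //; exact: ltW.
apply/ler_addgt0Pr => e e0; apply: ge_inf => //; split.
  by rewrite addr_ge0// ltW.
by apply: h; rewrite ltrDl.
Qed.

Lemma Theta_adapted p u t : 0 <= t -> F t [set w | Theta_fun p u w <= t].
Proof.
move=> t0; have [F0 FC FU] := filt_sigma F t0.
have FT : F t setT by rewrite -[setT]setD0; exact: FC.
have [u1|u1] := leP 1 u.
  rewrite (_ : [set w | _] = setT)//; apply/seteqP; split => // w _ /=.
  rewrite /Theta_fun (_ : [set r | _] = set0) ?inf0//.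
  apply/seteqP; split => // r [r0]; rewrite ltNge.
  by have /andP[_ /le_trans -> //] := rst_itv p w r0.
rewrite -filt_rcont// => s /=; rewrite in_itv/= andbT => ts.
have s0 : 0 <= s by rewrite (le_trans t0)// ltW.
have [Fs0 FsC FsU] := filt_sigma F s0.
pose r (k : nat) : R := t + (s - t) / k.+1%:R.
have tr k : t < r k by rewrite ltrDl divr_gt0 ?subr_gt0.
have rs k : r k <= s.
  by rewrite -lerBrDl ler_pdivrMr// ler_peMr ?ler1n// subr_ge0 ltW.
rewrite (_ : [set w | _] = setT `\` \bigcup_k (p (r k) @^-1` `]-oo, u])).
  apply: FsC; apply: FsU => k; apply: (@filt_mono _ _ _ _ F (r k)) => //.
    by rewrite (le_trans t0)// ltW.
  apply: rst_adapted; last exact: measurable_itv.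
  by rewrite (le_trans t0)// ltW.
apply/seteqP; split=> w /=.
  move/(Theta_le p w u1 t0) => h; split=> // -[k _] /=.
  by rewrite in_itv/= leNgt h.
move=> [_ h]; apply/(Theta_le p w u1 t0) => v tv.
have [k rv] : exists k, r k <= v.
  have : ((s - t) / k.+1%:R) @[k --> \oo] --> ((s - t) * 0 : R).
    by apply: cvgMr; exact: cvg_harmonic.
  rewrite mulr0 => /cvgr_le /(_ (v - t)).
  rewrite subr_gt0 => /(_ tv) [k _ hk]; exists k.
  by rewrite -lerBrDl; apply: hk => /=.
apply: (@lt_le_trans _ _ (p (r k) w)).
  rewrite ltNge; apply/negP => le; apply: h; exists k => //=.
by apply: rst_nd => //; rewrite (le_trans t0)// ltW.
Qed.

Definition Theta (p : randomized_stopping_time) (u : R) : stopping_time :=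
  StoppingTime (Theta_ge0 p u) (@Theta_adapted p u).

Definition iota_fun (tau : stopping_time) (t : R) (w : Omega) : R :=
  (tau w <= t)%R%:R.

Lemma iota_lt0 (tau : stopping_time) t w : t < 0 -> iota_fun tau t w = 0.
Proof.
by move=> t0; rewrite /iota_fun leNgt (lt_le_trans t0) ?st_ge0.
Qed.

Lemma iota_itv (tau : stopping_time) t w :
  0 <= t -> 0 <= iota_fun tau t w <= 1.
Proof. by move=> _; rewrite ler0n -[leRHS]/(1%:R) ler_nat leq_b1. Qed.

Lemma iota_adapted (tau : stopping_time) t : 0 <= t ->
  forall B : set R, measurable B -> F t (iota_fun tau t @^-1` B).
Proof.
move=> t0 B _; have [F0 FC FU] := filt_sigma F t0.
have FA := st_adapted tau t0.
have FT : F t setT by rewrite -[setT]setD0; exact: FC.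
have [B1|B1] := pselect (B 1); have [B0|B0] := pselect (B 0).
- rewrite (_ : _ @^-1` _ = setT)//; apply/seteqP; split => // w _ /=.
  by rewrite /iota_fun; case: (_ <= _).
- rewrite (_ : _ @^-1` _ = [set w | tau w <= t])//.
  by apply/seteqP; split => w /=; rewrite /iota_fun; case: (_ <= _).
- rewrite (_ : _ @^-1` _ = setT `\` [set w | tau w <= t]); first exact: FC.
  by apply/seteqP; split => w /=; rewrite /iota_fun;
    case: (_ <= _) => // -[_] /(_ isT).
- rewrite (_ : _ @^-1` _ = set0)//; apply/seteqP; split => // w /=.
  by rewrite /iota_fun; case: (_ <= _).
Qed.

Lemma iota_rcont (tau : stopping_time) w t : 0 <= t ->
  iota_fun tau s w @[s --> t^'+] --> iota_fun tau t w.
Proof.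
move=> t0; apply: cvg_near_cst; rewrite /iota_fun.
have [taut|ttau] := leP (tau w) t.
  near=> s.
  have ts : t <= s by near: s; exact: nbhs_right_ge.
  by rewrite (le_trans taut ts).
near=> s.
have st : s < tau w by near: s; exact: nbhs_right_lt.
by rewrite leNgt st.
Unshelve. all: by end_near. Qed.

Lemma iota_llim (tau : stopping_time) w t : 0 <= t ->
  cvg (iota_fun tau s w @[s --> t^'-]).
Proof.
move=> t0; apply/cvg_ex; rewrite /iota_fun.
have [taut|ttau] := ltP (tau w) t.
  exists 1; apply: cvg_near_cst; near=> s.
  have ts : tau w <= s by near: s; exact: nbhs_left_ge.
  by rewrite ts.
exists 0; apply: cvg_near_cst; near=> s.
have st : s < t by near: s; exact: nbhs_left_lt.
by rewrite leNgt (lt_le_trans st ttau).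
Unshelve. all: by end_near. Qed.

Lemma iota_nd (tau : stopping_time) w s t : 0 <= s -> s <= t ->
  iota_fun tau s w <= iota_fun tau t w.
Proof.
move=> _ st; rewrite /iota_fun ler_nat.
by have [h|//] := leP (tau w) s; rewrite (le_trans h st).
Qed.

Lemma iota_infty (tau : stopping_time) w :
  iota_fun tau t w @[t --> +oo] --> (1 : R).
Proof.
apply: cvg_near_cst; rewrite /iota_fun; near=> t.
have tt : tau w <= t by near: t; apply: nbhs_pinfty_ge; rewrite num_real.
by rewrite tt.
Unshelve. all: by end_near. Qed.

Definition iota_st (tau : stopping_time) : randomized_stopping_time :=
  RandomizedStoppingTime (@iota_lt0 tau) (@iota_itv tau) (@iota_adapted tau)
    (@iota_rcont tau) (@iota_llim tau) (@iota_nd tau) (@iota_infty tau).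

End strategies.

Definition alpha_potential (R : realType) (N : nat) (S : Type) (alpha : R)
    (K : 'I_N -> ('I_N -> S) -> R) (Psi : ('I_N -> S) -> R) :=
  forall (i : 'I_N) (a : 'I_N -> S) (b : S),
    `| (K i (dfwith a i b) - K i a) - (Psi (dfwith a i b) - Psi a) | <= alpha.

Definition cube (R : realType) (N : nat) : set (N.-tuple R) :=
  [set u | forall i, 0 <= tnth u i <= 1].

(* Lebesgue measurability, i.e. measurability for the completion of mu *)
Definition completed_measurable_fun (R : realType) (d : measure_display)
    (T : measurableType d) (mu : {measure set T -> \bar R}) (D : set T)
    (f : T -> R) :=
  exists2 g : T -> R, measurable_fun D g & ae_eq mu D f g.

Arguments cube : clear implicits.

Section game.
Context (R : realType) (d : measure_display) (Omega : measurableType d).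
Context (P : probability Omega R) (F : usual_filtration P) (N : nat).

Definition payoff_domain : set (Omega * N.-tuple R) :=
  [set z | forall j, 0 <= tnth z.2 j].

Definition stopped_payoff (G : 'I_N -> Omega * N.-tuple R -> R) (i : 'I_N)
    (tau : 'I_N -> stopping_time F) (w : Omega) : R :=
  G i (w, [tuple tau j w | j < N]).

Definition pure_payoff (G : 'I_N -> Omega * N.-tuple R -> R) (i : 'I_N)
    (tau : 'I_N -> stopping_time F) : R :=
  fine 'E_P[stopped_payoff G i tau].

Definition Theta_profile (p : 'I_N -> randomized_stopping_time F)
    (u : N.-tuple R) : 'I_N -> stopping_time F :=
  fun j => Theta (p j) (tnth u j).

Definition randomize (Phi : ('I_N -> stopping_time F) -> R)
    (p : 'I_N -> randomized_stopping_time F) : R :=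
  \int[lebesgue_tuple R N]_(u in cube R N) Phi (Theta_profile p u).

Definition randomized_payoff (G : 'I_N -> Omega * N.-tuple R -> R)
    (i : 'I_N) : ('I_N -> randomized_stopping_time F) -> R :=
  randomize (pure_payoff G i).

Definition iota_profile (tau : 'I_N -> stopping_time F) :
    'I_N -> randomized_stopping_time F := fun j => iota_st (tau j).

End game.

(* Main.v *)
(* (1) For every u the profile of hitting times of a deviation p^i -> q differs
   from that of p by the pure deviation Theta(q, u_i), so the alpha-potential
   inequality holds pointwise in u and integrates over the unit cube.  The
   integrals are finite: the J_i are uniformly bounded, and since any two pure
   profiles are joined by N unilateral deviations, Phi is bounded as well.
   (2) For u in [0, 1[ the hitting time of the embedded process iota(tau) is
   tau, so J^R_i o iota = J_i and the inequality restricts to T^N. *)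
Require Import Defs.
From mathcomp Require Import all_boot all_order all_algebra.
From mathcomp Require Import all_classical all_reals all_analysis.
From mathcomp Require Import measurable_realfun.
Import Order.TTheory GRing.Theory Num.Theory.
Import numFieldNormedType.Exports.
Set Implicit Arguments.
Unset Strict Implicit.
Unset Printing Implicit Defensive.
Local Open Scope classical_set_scope.
Local Open Scope ring_scope.

(** * Null sets under the integral sign and completed measurability *)

Section negligible_integral_nonmeasurable.
Context (R : realType) (d : measure_display) (T : measurableType d).
Variable mu : {measure set T -> \bar R}.
Import HBNNSimple.

(** [proj_nnsfun] multiplies [h] by the indicator of the complement of [N], which changes it only on
    a null set. *)
Lemma sintegral_setD_null (N : set T) (mN : measurable N)
    (h : {nnsfun T >-> R}) : mu N = 0%E ->
  sintegral mu h = sintegral mu (proj_nnsfun h (measurableC mN)).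
Proof.
move=> N0; transitivity (\int[mu]_x (h x)%:E)%E.
  by rewrite integral_nnsfun// patch_setT.
rewrite (ge0_negligible_integral mN)//; last 2 first.
- exact/measurable_EFinP.
- by move=> x _; rewrite lee_fin.
by rewrite integral_nnsfun ?setTD -?mrestrict//; exact: measurableC.
Qed.

(** Two suprema over simple functions are compared. A simple function below [f] on [D] keeps its
    integral when cut off on [N], and then lies below [f] on [D] minus [N]; the converse inclusion
    uses [f >= 0]. *)
Lemma ge0_integral_setD_null (D N : set T) (f : T -> \bar R) :
  measurable N -> mu N = 0%E -> (forall x, 0 <= f x)%E ->
  (\int[mu]_(x in D) f x = \int[mu]_(x in D `\` N) f x)%E.
Proof.
move=> mN N0 f0; rewrite !ge0_integralE//.
apply/eqP; rewrite eq_le; apply/andP; split.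
  apply: ge_ereal_sup => /= _ [h /= hf <-].
  apply: ereal_sup_ubound => /=; exists (proj_nnsfun h (measurableC mN)).
    move=> x /=; rewrite mindicE/=; have := hf x; rewrite !patchE.
    have [xN|xN] := boolP (x \in ~` N).
      rewrite mulr1; rewrite inE in xN.
      by rewrite in_setD -in_setC (mem_set xN) andbT.
    rewrite mulr0 => _; case: ifPn => // _; exact: f0.
  by rewrite -sintegral_setD_null.
apply: ge_ereal_sup => /= _ [h /= hf <-].
apply: ereal_sup_ubound => /=; exists h => // x.
apply: (le_trans (hf x)); rewrite !patchE in_setD.
by have [xD|xD] := boolP (x \in D) => //=; case: ifPn.
Qed.

(* No measurability of f is required: the integral of a nonnegative function
   is a supremum over the simple functions below it. *)
Lemma integral_setD_null (D N : set T) (f : T -> \bar R) :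
  measurable N -> mu N = 0%E ->
  (\int[mu]_(x in D) f x = \int[mu]_(x in D `\` N) f x)%E.
Proof.
by move=> mN N0; rewrite integralE [in RHS]integralE;
  congr (_ - _)%E; exact: ge0_integral_setD_null.
Qed.

Lemma Rintegral_setD_null (D N : set T) (f : T -> R) :
  measurable N -> mu N = 0%E ->
  \int[mu]_(x in D) f x = \int[mu]_(x in D `\` N) f x.
Proof. by move=> mN N0; rewrite /Rintegral (integral_setD_null _ _ mN). Qed.

(** Off a measurable null set covering the points of disagreement, [f] coincides with its measurable
    version. *)
Lemma completed_measurable_fun_null (D : set T) (f : T -> R) :
  measurable D -> completed_measurable_fun mu D f ->
  exists N, [/\ measurable N, mu N = 0%E & measurable_fun (D `\` N) f].
Proof.
move=> mD [g mg [N [mN N0 fgN]]]; exists N; split => //.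
apply: (@eq_measurable_fun _ _ _ _ _ g).
  move=> x /set_mem[Dx Nx]; apply/esym; apply: contrapT => fgx; apply: Nx.
  by apply: fgN => /= /(_ Dx).
by apply: measurable_funS mg.
Qed.

Lemma bounded_integrable (D : set T) (f : T -> R) (M : R) :
  measurable D -> (mu D < +oo)%E -> measurable_fun D f ->
  (forall x, D x -> `|f x| <= M) -> mu.-integrable D (EFin \o f).
Proof.
move=> mD Doo mf fM; apply: measurable_bounded_integrable => //.
exists M; split; first exact: num_real.
by move=> y My x Dx; exact: le_trans (fM _ Dx) (ltW My).
Qed.

End negligible_integral_nonmeasurable.

(** * The unit cube and its null upper faces *)

Section cube.
Context (R : realType) (N : nat).

Lemma measurable_box (A : 'I_N -> set R) : (forall i, measurable (A i)) ->
  measurable [set x : N.-tuple R | forall i, A i (tnth x i)].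
Proof.
move=> mA; rewrite (_ : [set x | _] = \big[setI/setT]_(i < N)
    ((fun x : N.-tuple R => tnth x i) @^-1` A i)).
  apply: bigsetI_measurable => i _; rewrite -[X in measurable X]setTI.
  exact: measurable_tnth.
rewrite -bigcap_seq; apply/seteqP; split => x /= h i; first by move=> _; exact: h.
by apply: h => /=; rewrite mem_index_enum.
Qed.

(** The boolean treats both cubes at once: [BSide false 1] includes the endpoint 1, [BSide true 1]
    excludes it. *)
Let box b := [set x : N.-tuple R |
  forall i, [set` Interval (BLeft 0) (BSide b 1)] (tnth x i)].

Let mbox b : measurable (box b).
Proof.
by apply: (@measurable_box
  (fun=> [set` Interval (BLeft 0) (BSide b 1)])) => i; exact: measurable_itv.
Qed.

Lemma cubeE : cube R N = box false.
Proof. by apply/seteqP; split => x /= h i; have := h i; rewrite /= in_itv. Qed.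

Lemma measurable_cube : measurable (cube R N).
Proof. by rewrite cubeE. Qed.

Let box1 b : lebesgue_tuple R N (box b) = 1%E.
Proof.
rewrite (@lebesgue_tuple_box R N
  (fun=> [set` Interval (BLeft 0) (BSide b 1)])); last by move=> i; exact: measurable_itv.
by rewrite big1// => i _; rewrite lebesgue_measure_itv/= lte_fin ltr01 sube0.
Qed.

Lemma lebesgue_tuple_cube : lebesgue_tuple R N (cube R N) = 1%E.
Proof. by rewrite cubeE box1. Qed.

Lemma lebesgue_tuple_cube_fin : (lebesgue_tuple R N (cube R N) < +oo)%E.
Proof. by rewrite lebesgue_tuple_cube ltry. Qed.

(** These are the points with some coordinate equal to 1, where [Theta_fun] takes its default value
    0. *)
Definition cube_face : set (N.-tuple R) :=
  cube R N `\` [set u | forall i, 0 <= tnth u i < 1].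

(** The closed and the half-open cube both have measure 1, so their difference is null. *)
Lemma cube_face_null :
  measurable cube_face /\ lebesgue_tuple R N cube_face = 0%E.
Proof.
have E : [set u : N.-tuple R | forall i, 0 <= tnth u i < 1] = box true.
  by apply/seteqP; split => x /= h i; have := h i; rewrite /= in_itv.
rewrite /cube_face E cubeE; split; first exact: measurableD.
have sub : box true `<=` box false.
  by move=> x h i; have := h i; rewrite /= !in_itv/= => /andP[-> /ltW].
transitivity (lebesgue_tuple R N (box false) - lebesgue_tuple R N (box true))%E.
  rewrite -{2}(setIidr sub); apply: measureD => //.
  by have := ltry (1 : R); rewrite -(box1 false).
by rewrite !box1 subee.
Qed.

Lemma Rintegral_cube_cst (f : N.-tuple R -> R) (c : R) :
  (forall u : N.-tuple R, (forall i, 0 <= tnth u i < 1) -> f u = c) ->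
  \int[lebesgue_tuple R N]_(u in cube R N) f u = c.
Proof.
move=> fc; have [mf f0] := cube_face_null.
rewrite (Rintegral_setD_null _ _ mf f0) (@eq_Rintegral _ _ _ _ _ (cst c)).
  rewrite -(Rintegral_setD_null _ _ mf f0).
  rewrite Rintegral_cst; last exact: measurable_cube.
  by rewrite [X in fine X]lebesgue_tuple_cube mulr1.
move=> u /set_mem[cu nu]; apply: fc; apply: contrapT => h; exact: nu.
Qed.

End cube.

(** * Unilateral deviations of profiles *)

(** Serves both directions of the theorem: [f j] is the hitting time at level [u_j] in one, the
    embedding of stopping times in the other. *)
Lemma dfwith_comp (I : eqType) (S T : Type) (f : I -> S -> T) (a : I -> S)
    (i : I) (b : S) :
  (fun j => f j (dfwith a i b j)) = dfwith (fun j => f j (a j)) i (f i b).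
Proof.
apply/funext => j; have [->|ij] := eqVneq j i; first by rewrite !dfwithin.
by rewrite !dfwithout// eq_sym.
Qed.

(* Two profiles are joined by a chain of N unilateral deviations. *)
Lemma unilateral_bounded (R : realType) (N : nat) (S : Type)
    (Psi : ('I_N -> S) -> R) (M : R) :
  (forall i a b, `|Psi (dfwith a i b) - Psi a| <= M) ->
  forall a b, `|Psi b - Psi a| <= N%:R * M.
Proof.
move=> dM a b; pose h k (j : 'I_N) := if (j < k)%N then b j else a j.
have hN : h N = b by apply/funext => j; rewrite /h ltn_ord.
suff hk k : (k <= N)%N -> `|Psi (h k) - Psi a| <= k%:R * M.
  by rewrite -{1}hN; exact: hk.
elim: k => [_|k IHk kN]; first by rewrite mul0r subrr normr0.
have -> : h k.+1 = dfwith (h k) (Ordinal kN) (b (Ordinal kN)).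
  apply/funext => j; have [->|jk] := eqVneq j (Ordinal kN).
    by rewrite dfwithin /h/= ltnS leqnn.
  rewrite dfwithout ?[_ == j]eq_sym// /h ltnS leq_eqVlt.
  by rewrite -val_eqE/= in jk; rewrite (negbTE jk).
rewrite -(subrK (Psi (h k)) (Psi (dfwith _ _ _))) -addrA mulrSr mulrDl mul1r addrC.
by rewrite (le_trans (ler_normD _ _))// lerD// IHk// ltnW.
Qed.


(** * Measurability of stopping times and hitting times *)

Section stopping.
Context (R : realType) (d : measure_display) (Omega : measurableType d).
Context (P : probability Omega R) (F : usual_filtration P).

(** Sublevel sets at negative levels are empty, so levels [t >= 0], the only times the filtration
    controls, are enough. *)
Lemma measurable_sublevel (d' : measure_display) (T : measurableType d')
    (f : T -> R) : (forall x, 0 <= f x) ->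
  (forall t : R, 0 <= t -> measurable [set x | f x <= t]) ->
  measurable_fun setT f.
Proof.
move=> f0 mf; apply: (measurability _ (RGenOInfty.measurableE R)) => //.
move=> _ [_ [t ->] <-]; rewrite setTI.
rewrite (_ : _ @^-1` _ = ~` [set x | f x <= t]); last first.
  by apply/seteqP; split => x /=; rewrite in_itv/= andbT ltNge => /negP.
apply: measurableC; have [t0|t0] := leP 0 t; first exact: mf.
rewrite (_ : [set x | _] = set0)//; apply/seteqP; split => // x /=.
by rewrite leNgt (lt_le_trans t0).
Qed.

Lemma measurable_stopping_time (tau : stopping_time F) : measurable_fun setT tau.
Proof.
apply: measurable_sublevel => [|t t0]; first exact: st_ge0.
exact: (filt_sub t0 (st_adapted tau t0)).
Qed.

Lemma measurable_rst (p : randomized_stopping_time F) (t : R) :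
  0 <= t -> measurable_fun setT (p t).
Proof.
move=> t0 _ B mB; rewrite setTI.
exact: (filt_sub t0 (rst_adapted p t0 mB)).
Qed.

Lemma Theta_fun_ge1 (p : randomized_stopping_time F) (u : R) w :
  1 <= u -> Theta_fun p u w = 0.
Proof.
move=> u1; rewrite /Theta_fun (_ : [set r | _] = set0) ?inf0//.
apply/seteqP; split => // r [r0]; rewrite ltNge.
by have /andP[_ /le_trans -> //] := rst_itv p w r0.
Qed.

(** Since paths are nondecreasing, the times [t + 1/(k+1)] can replace all [s > t] in [Theta_le],
    which makes the condition countable. *)
Lemma Theta_fun_le_seq (p : randomized_stopping_time F) (u : R) w (t : R) :
  u < 1 -> 0 <= t ->
  Theta_fun p u w <= t <-> forall k, u < p (t + k.+1%:R^-1) w.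
Proof.
move=> u1 t0; split => [/(Theta_le p w u1 t0) h k|h].
  by apply: h; rewrite ltrDl.
apply/(Theta_le p w u1 t0) => s ts.
have e0 : 0 < s - t by rewrite subr_gt0.
have [k _ /(_ k (leqnn k)) /= hk] := near_infty_natSinv_lt (PosNum e0).
apply: lt_le_trans (h k) _; apply: rst_nd; first by rewrite addr_ge0.
by rewrite -lerBrDl ltW.
Qed.

(** Joint measurability in state and level, as Tonelli requires: each sublevel set is built from
    countably many sets [u < p s w] at fixed times [s]. *)
Lemma measurable_Theta_fun (p : randomized_stopping_time F) :
  measurable_fun setT (fun z : Omega * R => Theta_fun p z.2 z.1).
Proof.
apply: measurable_sublevel => [z|t t0]; first exact: Theta_ge0.
pose B k := [set z : Omega * R | z.2 < p (t + k.+1%:R^-1) z.1].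
(* Levels [u >= 1] are split off: there the default value 0 is at most [t]. *)
have -> : [set z : Omega * R | Theta_fun p z.2 z.1 <= t] =
    [set z | 1 <= z.2] `|` \bigcap_k B k.
  apply/seteqP; split => -[w u] /=.
    have [u1|u1] := leP 1 u; first by left.
    by move=> /(Theta_fun_le_seq p w u1 t0) h; right => k _; exact: h.
  have [u1|u1] := leP 1 u; first by move=> _; rewrite Theta_fun_ge1.
  by move=> [//|h]; apply/(Theta_fun_le_seq p w u1 t0) => k; exact: h.
have mset (b : Omega * R -> bool) : measurable_fun setT b ->
    measurable [set z | b z].
  by move=> /(_ measurableT [set true] I); rewrite setTI preimage_true.
apply: measurableU.
  apply: (mset (fun z => 1 <= z.2)).
  exact: measurable_fun_ler.
apply: bigcapT_measurable => k.
apply: (mset (fun z => z.2 < p (t + k.+1%:R^-1) z.1)).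
apply: measurable_fun_ltr => //.
apply: measurableT_comp; last exact: measurable_fst.
by apply: measurable_rst; rewrite addr_ge0.
Qed.

(** For [0 <= u < 1] the indicator path exceeds [u] exactly from time [tau w] on. *)
Lemma Theta_iota (tau : stopping_time F) (u : R) w :
  0 <= u < 1 -> Theta_fun (iota_st tau) u w = tau w.
Proof.
move=> /andP[u0 u1]; rewrite /Theta_fun.
rewrite (_ : [set t | _] = `[tau w, +oo[%classic); first by rewrite inf_itv.
apply/seteqP; split => t /=; rewrite /iota_fun in_itv/= andbT.
  by case: (tau w <= t) => // -[_]; rewrite ltNge u0.
by move=> taut; rewrite taut; split => //; rewrite (le_trans (st_ge0 tau w)).
Qed.

End stopping.

(** * Measurability of payoffs and their value on embedded profiles *)

Section game.
Context (R : realType) (d : measure_display) (Omega : measurableType d).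
Context (P : probability Omega R) (F : usual_filtration P) (N : nat).
Variable G : 'I_N -> Omega * N.-tuple R -> R.
Hypothesis mG : forall i, measurable_fun (@payoff_domain R d Omega N) (G i).

Lemma measurable_payoff_domain : measurable (@payoff_domain R d Omega N).
Proof.
rewrite (_ : @payoff_domain _ _ _ _ = setT `*`
    [set u : N.-tuple R | forall i : 'I_N, `[0, +oo[%classic (tnth u i)]).
  apply: measurableX => //.
  by apply: (measurable_box (A := fun=> _)) => i; exact: measurable_itv.
apply/seteqP; split => -[w u] /=; first move=> h; last move=> [_ h].
  by split => // i; rewrite in_itv/= andbT; exact: h.
by move=> i; have := h i; rewrite /= in_itv/= andbT.
Qed.

(** [G i] is measurable on nonnegative times only, so the composition has to factor through
    [payoff_domain]. *)
Lemma measurable_payoff_comp (d' : measure_display) (T : measurableType d')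
    (i : 'I_N) (a : T -> Omega) (t : 'I_N -> T -> R) :
  measurable_fun setT a -> (forall j, measurable_fun setT (t j)) ->
  (forall j x, 0 <= t j x) ->
  measurable_fun setT (fun x => G i (a x, [tuple t j x | j < N])).
Proof.
move=> ma mt t0.
apply: (@measurable_comp _ _ _ _ _ _ (@payoff_domain R d Omega N) (G i) setT
  (fun x => (a x, [tuple t j x | j < N]))) => //.
- exact: measurable_payoff_domain.
- by move=> _ [x _ <-] j /=; rewrite tnth_mktuple.
apply: measurable_fun_pair => //; apply/measurable_fun_tnthP => j.
by apply: eq_measurable_fun (mt j) => x _ /=; rewrite tnth_mktuple.
Qed.

Lemma measurable_stopped_payoff (i : 'I_N) (tau : 'I_N -> stopping_time F) :
  measurable_fun setT (stopped_payoff G i tau).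
Proof.
apply: measurable_payoff_comp => // [j|j w]; first exact: measurable_stopping_time.
exact: st_ge0.
Qed.

(** The expectation is a difference of section integrals of the positive and negative parts of a
    jointly measurable payoff; each is measurable in [u] by Tonelli. *)
Lemma measurable_pure_payoff_Theta (i : 'I_N)
    (p : 'I_N -> randomized_stopping_time F) :
  measurable_fun setT (fun u => pure_payoff G i (Theta_profile p u)).
Proof.
pose g (z : Omega * N.-tuple R) : \bar R :=
  (stopped_payoff G i (Theta_profile p z.2) z.1)%:E.
have mg : measurable_fun setT g.
  apply/measurable_EFinP.
  apply: (@measurable_payoff_comp _ _ i fst
    (fun j (z : Omega * N.-tuple R) => Theta_fun (p j) (tnth z.2 j) z.1)) => //.
  - move=> j.
    have mj : measurable_fun setT
        (fun z : Omega * N.-tuple R => (z.1, tnth z.2 j)).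
      apply: measurable_fun_pair => //.
      exact: (measurableT_comp (@measurable_tnth _ R N j) measurable_snd).
    exact: measurableT_comp (measurable_Theta_fun (p j)) mj.
  - by move=> j z; exact: Theta_ge0.
have -> : (fun u => pure_payoff G i (Theta_profile p u)) =
    fun u => fine (fubini_G P (g^\+)%E u - fubini_G P (g^\-)%E u).
  apply/funext => u; rewrite /pure_payoff unlock integralE.
  by congr (fine (_ - _)); apply: eq_integral => w _;
    rewrite ?funeposE ?funenegE.
apply: measurableT_comp => //; apply: emeasurable_funB.
- apply: measurable_fun_fubini_tonelli_G => //; exact: measurable_funepos.
- apply: measurable_fun_fubini_tonelli_G => //; exact: measurable_funeneg.
Qed.

(** Off the null faces the integrand is constant, because payoffs depend on stopping times only
    through their values. *)
Lemma randomized_payoff_iota (i : 'I_N) (tau : 'I_N -> stopping_time F) :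
  randomized_payoff G i (iota_profile tau) = pure_payoff G i tau.
Proof.
apply: Rintegral_cube_cst => u u01; congr fine; congr expectation.
apply/funext => w; congr (G i (w, _)); apply: eq_mktuple => j.
exact: Theta_iota.
Qed.

(** * Uniform bounds and transfer of potentials between the two games *)

Hypothesis bG : forall i,
  (ereal_sup [set 'E_P[fun w => `|stopped_payoff G i tau w|%R]
    | tau in [set: 'I_N -> stopping_time F]] < +oo)%E.

Lemma pure_payoff_bounded : exists C : R,
  forall i (tau : 'I_N -> stopping_time F), `|pure_payoff G i tau| <= C.
Proof.
pose S i := (ereal_sup [set 'E_P[fun w => `|stopped_payoff G i tau w|%R]
  | tau in [set: 'I_N -> stopping_time F]])%E.
have Soo i : (S i < +oo)%E by exact: bG.
have leS i (tau : 'I_N -> stopping_time F) :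
    (`|'E_P[stopped_payoff G i tau]| <= S i)%E.
  apply: (@le_trans _ _ 'E_P[fun w => `|stopped_payoff G i tau w|%R]%E); last first.
    by apply: ereal_sup_ubound; exists tau.
  rewrite unlock; apply: le_abse_integral => //.
  exact/measurable_EFinP/measurable_stopped_payoff.
(* Summing over the finitely many players gives one constant for all of them. *)
exists (\sum_j `|fine (S j)|) => i tau.
apply: (@le_trans _ _ `|fine (S i)|); last first.
  by rewrite (bigD1 i)//= lerDl sumr_ge0.
apply: le_trans (ler_norm _).
have S0 : (0 <= S i)%E by apply: le_trans (leS i tau).
have Efin : 'E_P[stopped_payoff G i tau]%E \is a fin_num.
  by rewrite fin_num_abs (le_lt_trans (leS i tau)).
by rewrite /pure_payoff -fine_abse// fine_le ?abse_fin_num// ge0_fin_numE.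
Qed.

(** A unilateral deviation moves [Phi] by at most [alpha] plus the change in payoff, hence by at
    most [alpha + 2C]; a chain of [N] deviations gives the bound. *)
Lemma potential_bounded (alpha : R) (Phi : ('I_N -> stopping_time F) -> R) :
  alpha_potential alpha (pure_payoff G) Phi ->
  exists M : R, forall a b, `|Phi b - Phi a| <= M.
Proof.
move=> pot; have [C JC] := pure_payoff_bounded.
exists (N%:R * (alpha + (C + C))); apply: unilateral_bounded => i a b.
rewrite -[X in `|X|](subrK (pure_payoff G i (dfwith a i b) - pure_payoff G i a)).
rewrite (le_trans (ler_normD _ _))// lerD//; first by rewrite distrC; exact: pot.
by rewrite (le_trans (ler_normB _ _))// lerD.
Qed.

Lemma alpha_potential_randomize (alpha : R)
    (Phi : ('I_N -> stopping_time F) -> R) :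
  (forall p : 'I_N -> randomized_stopping_time F,
     completed_measurable_fun (lebesgue_tuple R N) (cube R N)
       (fun u => Phi (Theta_profile p u))) ->
  alpha_potential alpha (pure_payoff G) Phi ->
  alpha_potential alpha (randomized_payoff G) (randomize Phi).
Proof.
move=> mPhi pot i p q; set p' := dfwith p i q.
have [C JC] := pure_payoff_bounded; have [M PhiM] := potential_bounded pot.
have mD := @measurable_cube R N; set mu := lebesgue_tuple R N.
have [A [mA A0 fA]] := completed_measurable_fun_null mD (mPhi p).
have [A' [mA' A'0 fA']] := completed_measurable_fun_null mD (mPhi p').
have mB := measurableU _ _ mA mA'.
have B0 : mu (A `|` A') = 0%E.
  exact: etrans (measureU0 mA mA' A'0) A0.
(* On [D] the potentials along both [p] and [p'] are measurable, and the removed set [B] is null. *)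
set B := A `|` A' in mB B0; set D := cube R N `\` B.
have mDB : measurable D by exact: measurableD.
have Doo : (mu D < +oo)%E.
  apply: (@le_lt_trans _ _ (mu (cube R N))); last exact: lebesgue_tuple_cube_fin.
  by apply: le_measure; rewrite ?inE//; exact: subDsetl.
have iJ (r : 'I_N -> randomized_stopping_time F) : mu.-integrable D
    (EFin \o (fun u => pure_payoff G i (Theta_profile r u))).
  apply: (bounded_integrable mDB Doo (M := C)) => //.
  by apply: measurable_funTS; exact: measurable_pure_payoff_Theta.
(* A reference profile: only the oscillation of [Phi] is bounded so far, and [M + |Phi a0|] then
   bounds [Phi] itself. *)
pose a0 := Theta_profile p [tuple 0 | _ < N].
have iPhi (r : 'I_N -> randomized_stopping_time F) :
    measurable_fun D (fun u => Phi (Theta_profile r u)) ->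
    mu.-integrable D (EFin \o (fun u => Phi (Theta_profile r u))).
  move=> mr; apply: (bounded_integrable mDB Doo (M := M + `|Phi a0|)) => // u _.
  rewrite -[X in `|X|](subrK (Phi a0)).
  by rewrite (le_trans (ler_normD _ _))// lerD.
have iPhip : mu.-integrable D (EFin \o (fun u => Phi (Theta_profile p u))).
  apply: iPhi; apply: measurable_funS fA; first exact: measurableD.
  by apply: setDS; exact: subsetUl.
have iPhip' : mu.-integrable D (EFin \o (fun u => Phi (Theta_profile p' u))).
  apply: iPhi; apply: measurable_funS fA'; first exact: measurableD.
  by apply: setDS; exact: subsetUr.
have toD f : \int[mu]_(u in cube R N) f u = \int[mu]_(u in D) f u.
  exact: Rintegral_setD_null.
rewrite /randomized_payoff /randomize !toD.
rewrite -!RintegralB//; last 2 first.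
- exact: (integrableB mDB (iJ p') (iJ p)).
- exact: (integrableB mDB iPhip' iPhip).
have ih : mu.-integrable D (EFin \o (fun u =>
    (pure_payoff G i (Theta_profile p' u) - pure_payoff G i (Theta_profile p u)) -
    (Phi (Theta_profile p' u) - Phi (Theta_profile p u)))).
  exact: (integrableB mDB (integrableB mDB (iJ p') (iJ p))
    (integrableB mDB iPhip' iPhip)).
apply: le_trans (le_normr_Rintegral mDB ih) _.
(* [D] has the full measure 1 of the cube, so [alpha] can be written as an integral and compared
   pointwise. *)
have <- : \int[mu]_(u in D) alpha = alpha.
  by rewrite -toD; exact: Rintegral_cube_cst.
apply: le_Rintegral => //.
- exact: integrable_norm.
- by apply: (bounded_integrable mDB Doo (M := `|alpha|)).
move=> u _; have -> : Theta_profile p' u =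
    dfwith (Theta_profile p u) i (Theta q (tnth u i)).
  exact: (dfwith_comp (fun j r => Theta r (tnth u j))).
exact: pot.
Qed.

Lemma alpha_potential_iota (alpha : R)
    (PhiR : ('I_N -> randomized_stopping_time F) -> R) :
  alpha_potential alpha (randomized_payoff G) PhiR ->
  alpha_potential alpha (pure_payoff G) (PhiR \o @iota_profile _ _ _ _ F N).
Proof.
move=> pot i tau b; rewrite -!randomized_payoff_iota /=.
have -> : iota_profile (dfwith tau i b) = dfwith (iota_profile tau) i (iota_st b).
  exact: (dfwith_comp (fun=> @iota_st _ _ _ _ F)).
exact: pot.
Qed.

End game.

Theorem proposition2p9 (R : realType) (d : measure_display)
    (Omega : measurableType d) (P : probability Omega R)
    (F : usual_filtration P) (E : topologicalType) (X : R -> Omega -> E)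
    (N : nat) (G : 'I_N -> Omega * N.-tuple R -> R) (alpha : R)
    (N_ge2 : (2 <= N)%N)
    (X_continuous : continuous_process X)
    (F_generated : generated_by F X)
    (G_measurable : forall i, measurable_fun (@payoff_domain R d Omega N) (G i))
    (G_bounded : forall i,
      (ereal_sup [set 'E_P[fun w => `|stopped_payoff G i tau w|%R]
        | tau in [set: 'I_N -> stopping_time F]] < +oo)%E)
    (alpha_ge0 : 0 <= alpha) :
  (forall Phi : ('I_N -> stopping_time F) -> R,
     (forall p : 'I_N -> randomized_stopping_time F,
        completed_measurable_fun (lebesgue_tuple R N) (cube R N)
          (fun u => Phi (Theta_profile p u))) ->
     alpha_potential alpha (pure_payoff G) Phi ->
     alpha_potential alpha (randomized_payoff G) (randomize Phi)) /\
  (forall PhiR : ('I_N -> randomized_stopping_time F) -> R,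
     alpha_potential alpha (randomized_payoff G) PhiR ->
     alpha_potential alpha (pure_payoff G)
       (fun tau : 'I_N -> stopping_time F => PhiR (iota_profile tau))).
Proof.
split => [Phi|PhiR]; first exact: alpha_potential_randomize.
exact: alpha_potential_iota.
Qed.
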